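(* Let $A:U_\infty\to\mathcal M^{n\times n}_{\rm sym}$, $K:U_\infty\to\mathcal M^{n\times n}$ and $B:U_\infty\times J\to\mathbb R^n$ be such that, for some constants $c_0>0$, $M_1>0$, $c_1\ge0$, $c_2\ge0$ and for all $(x,t)\in U_\infty$, $\xi\in\mathbb R^n$, $$\xi^{\rm T}A(x,t)\xi\ge c_0|\xi|^2,\qquad{\rm Tr}(A(x,t))\le M_1,\qquad -c_1|\xi|^2\le\xi^{\rm T}K(x,t)\xi\le c_2|\xi|^2 .$$ Let $u\in C(\overline{U_\infty})\cap C^{2,1}_{x,t}(U_\infty)$, with $u(U_\infty)\subset J$, be a solution of the problem $$Lu=f\ \text{ in }U\times(0,\infty),\qquad u=g\ \text{ on }\Gamma\times(0,\infty),\qquad u(x,0)=u_0(x)\ \text{ in }U,$$ where $f:U_\infty\to\mathbb R$, $g:\Gamma\times(0,\infty)\to\mathbb R$, $u_0:U\to\mathbb R$ are given functions. Assume that $u$ satisfies the Range Condition (see context), and assume the following. (i) There are constants $c_B>0$ and $\gamma_0>0$ such that $|B(x,t,s)|\le c_B(1+|s|)^{\gamma_0}$ for all $(x,t)\in U_\infty$ and $s\in J$. (ii) There is a continuous function $F:[0,\infty)\to[0,\infty)$ such that $|f(x,t)|\le F(t)$ for all $(x,t)\in U_\infty$. (iii) The function $F$ in (ii) satisfies $\int_0^\infty F(\tau)\,{\rm d}\tau<\infty$. (iv) There is $u_*\in J$ such that $\lim_{t\to\infty}\left(\max_{x\in\Gamma}|g(x,t)-u_*|\right)=0$. Then $$\lim_{t\to\infty}\left(\max_{x\in\bar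 U}|u(x,t)-u_*|\right)=0.$$
   Context: $n\ge1$ is fixed; $U$ is a non-empty, open, bounded subset of $\mathbb R^n$ with boundary $\Gamma$ and closure $\bar U$. $U_\infty=U\times(0,\infty)$, $\overline{U_\infty}=\bar U\times[0,\infty)$. $\mathcal M^{n\times n}$ (resp. $\mathcal M^{n\times n}_{\rm sym}$) is the set of real (resp. real symmetric) $n\times n$ matrices. $C^{2,1}_{x,t}(U\times I)$ is the class of continuous functions on $U\times I$ with continuous partial derivatives $\partial u/\partial t$, $\partial u/\partial x_i$, $\partial^2u/\partial x_i\partial x_j$. $\langle A,B\rangle={\rm Tr}(A^{\rm T}B)$; $D^2u$, $\nabla u$ are the Hessian and gradient in $x$. $J$ is an interval in $\mathbb R$ with non-empty interior and $P\in C^1(J,\mathbb R)$ with $P'\in C(J,[0,\infty))$. The nonlinear operator $L$ is $$Lu=\frac{\partial u}{\partial t}-\langle A(x,t),D^2u\rangle+B(x,t,u)\cdot\nabla u+P'(u)(K(x,t)\nabla u)\cdot\nabla u.$$ Range Condition: either $J=\mathbb R$, or one of the following holds: if $J=[a,\infty)$ or $J=(-\infty,b]$, then $u(\overline{U_\infty})\subset J$; if $J=(a,\infty)$, then $u(\overline{U_\infty})\subset[m,\infty)$ for some $m>a$; if $J=(-\infty,b)$, then $u(\overline{U_\infty})\subset(-\infty,M]$ for some $M<b$; if $J$ is bounded, then $u(\overline{U_\infty})\subset[m,M]$ with $m,M\in J$. (That is, $u$ satisfies the requirement corresponding to the form of $J$.) *)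

(* Defs.v *)
From HB Require Import structures.
From mathcomp Require Import all_boot all_order all_algebra.
From mathcomp Require Import all_classical all_reals all_analysis.

Set Implicit Arguments.
Unset Strict Implicit.
Unset Printing Implicit Defensive.

Import Order.TTheory GRing.Theory Num.Theory.
Import numFieldNormedType.Exports.

Local Open Scope classical_set_scope.
Local Open Scope ring_scope.

(* Points of R^n are row vectors [x : 'rV[R]_n]; gradients and the other vectors
   on which matrices act are column vectors, so that the matrix formulas read as
   on paper.  The library norm [`|x|] on matrices is the sup norm;
   it induces the usual topology and bounded sets, but the Euclidean norm
   occurring in inequalities is [enorm]. *)

Section Vectors.
Context {R : realType} {n : nat}.

Definition dot (v w : 'cV[R]_n) : R := \sum_(i < n) v i 0 * w i 0.

Definition enorm (v : 'cV[R]_n) : R := Num.sqrt (dot v v).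

Definition quad (A : 'M[R]_n) (v : 'cV[R]_n) : R := (v^T *m A *m v) 0 0.

Definition mxinner (A B : 'M[R]_n) : R := \tr (A^T *m B).

End Vectors.

Section MaxOverSet.
Context {R : realType} {T : Type}.

Definition is_max (S : set R) (m : R) := S m /\ ubound S m.

(* For every [t > 0] the maximum of [h x t] over [x] in [S] exists, and it tends
   to [l] as [t --> +oo]. *)
Definition max_cvg (S : set T) (h : T -> R -> R) (l : R) :=
  exists2 m : R -> R,
    forall t, 0 < t -> is_max [set h x t | x in S] (m t) &
    m t @[t --> +oo] --> l.

End MaxOverSet.

Section DerivativeOnInterval.
Context {R : realType}.

(* The derivative relative to [J] is one-sided at the endpoints of [J] that
   belong to [J]; values of [P] outside [J] play no role. *)
Definition diff_quotient (P : R -> R) (s r : R) : R := (P r - P s) / (r - s).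

Definition derivable_on (J : set R) (P : R -> R) (s : R) :=
  cvg (diff_quotient P s r @[r --> within J s^']).

Definition derive_on (J : set R) (P : R -> R) (s : R) : R :=
  lim (diff_quotient P s r @[r --> within J s^']).

Definition C1_on (J : set R) (P : R -> R) :=
  (forall s, J s -> derivable_on J P s) /\ {within J, continuous (derive_on J P)}.

End DerivativeOnInterval.

Section Problem.
Context {R : realType} {n : nat}.
Implicit Types (U : set 'rV[R]_n) (u : 'rV[R]_n -> R -> R).

Definition frontier U : set 'rV[R]_n := closure U `\` interior U.

Definition cylinder U : set ('rV[R]_n * R) := U `*` `]0, +oo[.

Definition closed_cylinder U : set ('rV[R]_n * R) := closure U `*` `[0, +oo[.

Definition continuous_on (D : set ('rV[R]_n * R)) u :=
  {within D, continuous (fun p => u p.1 p.2)}.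

Definition dt u (x : 'rV[R]_n) (t : R) : R := derive1 (u x) t.

Definition dx (i : 'I_n) u (x : 'rV[R]_n) (t : R) : R :=
  'D_(delta_mx 0 i) (u^~ t) x.

Definition gradx u (x : 'rV[R]_n) (t : R) : 'cV[R]_n := \col_i dx i u x t.

Definition hessx u (x : 'rV[R]_n) (t : R) : 'M[R]_n :=
  \matrix_(i, j) dx i (dx j u) x t.

Definition C21 U u :=
  [/\ continuous_on (cylinder U) u,
      forall x t, cylinder U (x, t) ->
        [/\ derivable (u x) t 1,
            forall i, derivable (u^~ t) x (delta_mx 0 i) &
            forall i j, derivable ((dx j u)^~ t) x (delta_mx 0 i)],
      continuous_on (cylinder U) (dt u),
      forall i, continuous_on (cylinder U) (dx i u) &
      forall i j, continuous_on (cylinder U) (dx i (dx j u))].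

Definition opL (J : set R) (P : R -> R) (A K : 'rV[R]_n -> R -> 'M[R]_n)
    (B : 'rV[R]_n -> R -> R -> 'cV[R]_n) u (x : 'rV[R]_n) (t : R) : R :=
  dt u x t - mxinner (A x t) (hessx u x t)
  + dot (B x t (u x t)) (gradx u x t)
  + derive_on J P (u x t) * dot (K x t *m gradx u x t) (gradx u x t).

Definition range_condition U (J : set R) u :=
  let uran := [set u p.1 p.2 | p in closed_cylinder U] in
  J = setT \/
  [/\ forall a : R, J = [set` `[a, +oo[] \/ J = [set` `]-oo, a]] -> uran `<=` J,
      forall a : R, J = [set` `]a, +oo[] ->
        exists2 m, a < m & uran `<=` `[m, +oo[,
      forall b : R, J = [set` `]-oo, b[] ->
        exists2 M, M < b & uran `<=` `]-oo, M] &
      bounded_set J -> exists m M, [/\ J m, J M & uran `<=` `[m, M]]].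

End Problem.

(* Main.v *)
Require Import Defs.
From HB Require Import structures.
From mathcomp Require Import all_boot all_order all_algebra.
From mathcomp Require Import all_classical all_reals all_analysis.
From mathcomp Require Import measurable_realfun ring lra.
Import Order.TTheory GRing.Theory Num.Theory.
Import numFieldNormedType.Exports.
Local Open Scope classical_set_scope.
Local Open Scope ring_scope.

(* A function [v(x,t) = c(t) - eta exp(k x_1)] with small [eta] is a strict
   supersolution even though the equation is quasilinear: at a first point where
   [u] touches [v] the gradient of [u] equals that of [v], which is known, so the
   first order term and the quadratic gradient term are explicit and are dominated
   by [eta k^2 exp(k x_1) A_11 >= c0 eta k^2 exp(k x_1)]. The forcing is absorbed by
   putting a primitive of [F] into [c]. With [eta = 0] this bounds [u] globally, so
   that by the Range Condition [u] stays in a compact part of [J] and the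
   coefficients [B(x,t,u)] and [P'(u)] are bounded. With [eta > 0] and [c] decreasing
   linearly in time it drives [u] below the boundary limit up to any [eps]. The
   lower bound is the same statement for [-u]. *)

(** * Trace inner product of a positive definite and a negative semidefinite matrix *)

Section LinearAlgebra.
Context {R : realType}.

(** Entries are functions of indices, so that the induction on the dimension passes through
    [lift ord0] without block matrices. *)
Definition schur {n} (a : 'I_n.+1 -> 'I_n.+1 -> R) (i j : 'I_n) : R :=
  a (lift ord0 i) (lift ord0 j)
  - (a ord0 ord0)^-1 * (a (lift ord0 i) ord0 * a (lift ord0 j) ord0).

(** Subtracting the rank-one form built from the first column leaves entries [s] that vanish on the
    first row and column, so only lifted indices survive. It is applied both to [h] itself and to
    the rank-one [h] given by a vector. *)
Lemma schur_inner n (a h : 'I_n.+1 -> 'I_n.+1 -> R) :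
  a ord0 ord0 != 0 -> (forall i j, a i j = a j i) ->
  \sum_i \sum_j a i j * h i j =
    (a ord0 ord0)^-1 * (\sum_i \sum_j h i j * (a i ord0 * a j ord0))
    + \sum_i \sum_j schur a i j * h (lift ord0 i) (lift ord0 j).
Proof.
move=> a0 asym; pose s i j := a i j - (a ord0 ord0)^-1 * (a i ord0 * a j ord0).
have s0r i : s i ord0 = 0 by rewrite /s; field.
have s0l j : s ord0 j = 0 by rewrite /s (asym ord0 j); field.
have -> : \sum_i \sum_j schur a i j * h (lift ord0 i) (lift ord0 j) =
    \sum_i \sum_j s i j * h i j.
  rewrite [RHS]big_ord_recl [X in _ = X + _]big1 ?add0r => [|j _].
    2: by rewrite s0l mul0r.
  by apply: eq_bigr => i _; rewrite [RHS]big_ord_recl s0r mul0r add0r.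
rewrite mulr_sumr -big_split; apply: eq_bigr => i _ /=.
by rewrite mulr_sumr -big_split; apply: eq_bigr => j _ /=; rewrite /s; ring.
Qed.

(* Induction on the dimension: a Schur complement step writes [a] as a rank-one
   nonnegative form plus a positive definite form in one variable less. *)
Lemma inner_le0 n (a h : 'I_n -> 'I_n -> R) (c : R) :
  0 < c -> (forall i j, a i j = a j i) ->
  (forall x : 'I_n -> R,
    c * (\sum_i x i ^+ 2) <= \sum_i \sum_j a i j * (x i * x j)) ->
  (forall x : 'I_n -> R, \sum_i \sum_j h i j * (x i * x j) <= 0) ->
  \sum_i \sum_j a i j * h i j <= 0.
Proof.
move=> c0; elim: n a h => [|n IHn] a h asym apos hneg; first by rewrite big_ord0.
pose ext (y : R) (x : 'I_n -> R) i := oapp x y (unlift ord0 i).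
have ext0 y x : ext y x ord0 = y by rewrite /ext unlift_none.
have extS y x i : ext y x (lift ord0 i) = x i by rewrite /ext liftK.
have a00 : 0 < a ord0 ord0.
  have := apos (ext 1 (fun=> 0)).
  rewrite !big_ord_recl !ext0 big1 => [|i _]; last by rewrite extS expr0n.
  rewrite big1 => [|i _]; last by rewrite extS; ring.
  rewrite big1 => [|i _]; first lra.
  by rewrite big1 // => j _; rewrite extS; ring.
rewrite schur_inner ?gt_eqF//; rewrite -[leRHS]addr0; apply: lerD.
  by rewrite pmulr_rle0 ?invr_gt0.
apply: IHn => [i j|x|x].
- by rewrite /schur asym (mulrC (a (lift ord0 i) ord0)).
(* This first coordinate minimizes the form of [a] for given [x]: it annihilates the rank-one part,
   so the form of [a] at [ext y x] is the form of the Schur complement at [x]. *)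
- pose y := - (a ord0 ord0)^-1 * \sum_i a (lift ord0 i) ord0 * x i.
  have := apos (ext y x).
  rewrite schur_inner ?gt_eqF//.
  have -> : \sum_i \sum_j ext y x i * ext y x j * (a i ord0 * a j ord0) =
      (\sum_i a i ord0 * ext y x i) ^+ 2.
    rewrite expr2 mulr_suml; apply: eq_bigr => i _.
    by rewrite mulr_sumr; apply: eq_bigr => j _; ring.
  have -> : \sum_i a i ord0 * ext y x i = 0.
    rewrite big_ord_recl ext0.
    under eq_bigr do rewrite extS.
    by rewrite /y; field; rewrite gt_eqF.
  rewrite expr0n mulr0 add0r.
  under [in X in _ <= X -> _]eq_bigr do under eq_bigr do rewrite !extS.
  apply: le_trans.
  rewrite ler_pM2l// big_ord_recl.
  under [X in _ <= _ + X]eq_bigr do rewrite extS.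
  by rewrite lerDr sqr_ge0.
- have := hneg (ext 0 x).
  rewrite big_ord_recl big1 => [|j _]; last by rewrite ext0; ring.
  rewrite add0r; congr (_ <= _); apply: eq_bigr => i _.
  rewrite big_ord_recl ext0 !mulr0 add0r.
  by apply: eq_bigr => j _; rewrite !extS.
Qed.

Lemma quadE n (A : 'M[R]_n) (v : 'cV[R]_n) :
  quad A v = \sum_i \sum_j A i j * (v i 0 * v j 0).
Proof.
rewrite /quad mxE exchange_big; apply: eq_bigr => j _.
rewrite mxE mulr_suml; apply: eq_bigr => i _.
by rewrite mxE; ring.
Qed.

Lemma mxinnerE n (A B : 'M[R]_n) : mxinner A B = \sum_i \sum_j A i j * B i j.
Proof.
rewrite /mxinner /mxtrace exchange_big; apply: eq_bigr => i _.
by rewrite mxE; apply: eq_bigr => j _; rewrite mxE.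
Qed.

Lemma enorm_sqr n (v : 'cV[R]_n) : enorm v ^+ 2 = \sum_i v i 0 ^+ 2.
Proof.
rewrite /enorm sqr_sqrtr; first by apply: eq_bigr => i _; rewrite expr2.
by apply: sumr_ge0 => i _; rewrite -expr2 sqr_ge0.
Qed.

Lemma mxinner_le0 n (A H : 'M[R]_n) (c : R) :
  0 < c -> A^T = A -> (forall v, c * enorm v ^+ 2 <= quad A v) ->
  (forall v, quad H v <= 0) -> mxinner A H <= 0.
Proof.
move=> c0 /matrixP Asym Apos Hneg; rewrite mxinnerE.
apply: (@inner_le0 _ _ _ c) => // [i j|x|x].
- by have := Asym i j; rewrite mxE.
- have := Apos (\col_i x i); rewrite enorm_sqr quadE.
  under eq_bigr do rewrite mxE.
  by under [in X in _ <= X -> _]eq_bigr do under eq_bigr do rewrite !mxE.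
- have := Hneg (\col_i x i); rewrite quadE.
  by under [in X in X <= _ -> _]eq_bigr do under eq_bigr do rewrite !mxE.
Qed.

End LinearAlgebra.

(** * Directional derivatives and necessary conditions at a maximum *)

Section Derivatives.
Context {R : realType}.

(** The difference quotients agree as functions of [h], so differentiating along [v] and
    differentiating the restriction to a line are the same thing; the two transfer lemmas below rest
    on this. *)
Lemma growth_rate_line (V : normedModType R) (f : V -> R) (x v : V) (s : R) :
  (fun h : R => h^-1 *: ((f \o shift (x + s *: v)) (h *: v) - f (x + s *: v))) =
  (fun h : R =>
     h^-1 *: (((fun r => f (x + r *: v)) \o shift s) (h *: 1) - f (x + s *: v))).
Proof.
apply/funext => h /=; congr (_ *: (f _ - _)).
by rewrite scaler1 scalerDl addrCA.
Qed.

Lemma is_derive_line (V : normedModType R) (f : V -> R) (x v : V) (s d : R) :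
  is_derive (x + s *: v) v f d -> is_derive s 1 (fun r => f (x + r *: v)) d.
Proof.
have e := growth_rate_line _ f x v s.
by case=> df dE; split; [rewrite /derivable -e|rewrite /derive -e].
Qed.

Lemma line_is_derive (V : normedModType R) (f : V -> R) (x v : V) (d : R) :
  is_derive (0 : R) 1 (fun r => f (x + r *: v)) d -> is_derive x v f d.
Proof.
have := growth_rate_line _ f x v 0; rewrite scale0r addr0 => e.
by case; rewrite /derivable /derive /= scale0r addr0 -e => df dE; split.
Qed.

(** The step [b] may have either sign, hence the symmetric condition on [r]: the lemma is used with
    steps [h * a] of unknown sign. *)
Lemma MVT_line (V : normedModType R) (f f' : V -> R) (x v : V) (b : R) :
  (forall r : R, `|r| <= `|b| -> is_derive (x + r *: v) v f (f' (x + r *: v))) ->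
  exists2 r : R, `|r| <= `|b| & f (x + b *: v) - f x = b * f' (x + r *: v).
Proof.
move=> df; pose g (r : R) := f (x + r *: v).
pose g' (r : R) : R := f' (x + r *: v).
have dg (r : R) : `|r| <= `|b| -> is_derive r 1 g (g' r).
  by move=> rb; apply: is_derive_line; exact: df.
have cg (c d : R) : (forall r : R, c <= r <= d -> `|r| <= `|b|) ->
    {within `[c, d], continuous g}.
  move=> cdb; apply: derivable_within_continuous => r; rewrite in_itv/= => rcd.
  by have := dg _ (cdb _ rcd).
have [b0|b0] := leP 0 b.
- have sub (r : R) : 0 <= r <= b -> `|r| <= `|b|.
    by move=> /andP[r0 rb]; rewrite !ger0_norm.
  have dgo (r : R) : r \in `]0, b[%R -> is_derive r 1 g (g' r).
    by rewrite in_itv/= => /andP[r0 rb]; apply/dg/sub; rewrite !ltW.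
  have [r] := MVT_segment b0 dgo (cg _ _ sub).
  rewrite in_itv/= => /sub rb; rewrite /g scale0r addr0 subr0 => ->.
  by exists r => //; rewrite mulrC.
- have sub (r : R) : b <= r <= 0 -> `|r| <= `|b|.
    by move=> /andP[r0 rb]; rewrite !ler0_norm ?lerN2// ltW.
  have dgo (r : R) : r \in `]b, 0[%R -> is_derive r 1 g (g' r).
    by rewrite in_itv/= => /andP[r0 rb]; apply/dg/sub; rewrite !ltW.
  have [r] := MVT_segment (ltW b0) dgo (cg _ _ sub).
  rewrite in_itv/= => /sub rb; rewrite /g scale0r addr0 => gE.
  by exists r => //; rewrite -opprB gE /g'; ring.
Qed.

(** Move first along [v], then along [e]. The first increment gives [d]; the second is a mean value
    of [f'] at a point near [x], and continuity of [f'] at [x] gives its limit. *)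
Lemma is_derive_addZ (V : normedModType R) (f f' : V -> R) (x v e : V) (a d : R) :
  is_derive x v f d -> (\forall y \near x, is_derive y e f (f' y)) ->
  {for x, continuous f'} ->
  is_derive x (a *: e + v) f (a * f' x + d).
Proof.
move=> [dfv <-] de ce.
suff q : (fun h : R => h^-1 *: ((f \o shift x) (h *: (a *: e + v)) - f x)) @ 0^'
    --> (a * f' x + 'D_v f x : R).
  by split; [apply/cvg_ex; eexists; exact: q | exact/cvg_lim].
have -> : (fun h : R => h^-1 *: ((f \o shift x) (h *: (a *: e + v)) - f x)) =
    (fun h : R => h^-1 *: (f (x + h *: v + (h * a) *: e) - f (x + h *: v)))
    \+ (fun h : R => h^-1 *: ((f \o shift x) (h *: v) - f x)).
  apply/funext => h /=; rewrite -scalerDr (addrC (h *: v) x) addrA addrNK.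
  by rewrite [h *: (_ + _)]scalerDr scalerA (addrC _ x) (addrC (_ *: e)) addrA.
apply: cvgD; last exact: dfv.
apply/cvgrPdist_lt => eps eps0.
have a1 : 0 < `|a| + 1 by rewrite ltr_wpDl.
have : \forall y \near x, is_derive y e f (f' y) /\
    `|f' x - f' y| < eps / (`|a| + 1).
  apply: filterI => //.
  by move/cvgrPdist_lt : ce; apply; rewrite divr_gt0.
case/nbhs_ballP => del /= del0 Hdel.
(* This factor times [|h|] bounds the distance from [x] of every point met by the two moves. *)
have w0 : 0 < `|v| + `|a| * `|e| + 1 by rewrite ltr_wpDl// addr_ge0// mulr_ge0.
near=> h.
have h0 : h != 0 by near: h; exact: nbhs_dnbhs_neq.
have hw : `|h| * (`|v| + `|a| * `|e| + 1) < del.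
  rewrite -ltr_pdivlMr//; near: h.
  by apply: dnbhs0_lt; exact: divr_gt0.
have bal (r : R) : `|r| <= `|h * a| -> ball x del (x + h *: v + r *: e).
  move=> rha; rewrite -ball_normE /= -addrA opprD addrA subrr sub0r normrN.
  apply: le_lt_trans hw; apply: (le_trans (ler_normD _ _)).
  rewrite !normrZ mulrDr mulr1 mulrDr -addrA lerD2l mulrA -normrM.
  by apply: ler_wpDr => //; exact: ler_wpM2r.
have [r rha ->] := @MVT_line _ f f' (x + h *: v) e (h * a)
  (fun r rha => (Hdel _ (bal r rha)).1).
have -> : h^-1 *: (h * a * f' (x + h *: v + r *: e) : R) =
    a * f' (x + h *: v + r *: e).
  by rewrite /GRing.scale/= -mulrA mulKf.
rewrite -mulrBr normrM; have [_] := Hdel _ (bal r rha).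
rewrite ltr_pdivlMr// => /(le_lt_trans _); apply.
by rewrite mulrC ler_wpM2l// lerDl.
Unshelve. all: by end_near. Qed.

(** Continuous partial derivatives give linearity in the direction: [v] is built from the zero
    direction by adding one coordinate direction at a time. *)
Lemma is_derive_rV n (f : 'rV[R]_n -> R) (f' : 'I_n -> 'rV[R]_n -> R)
    (x v : 'rV[R]_n) :
  (forall i, \forall y \near x, is_derive y (delta_mx 0 i) f (f' i y)) ->
  (forall i, {for x, continuous (f' i)}) ->
  is_derive x v f (\sum_i v 0 i * f' i x).
Proof.
move=> df cf; rewrite [in is_derive _ _](row_sum_delta v).
elim/big_rec2: _ => [|i d w _ IH].
  by split; [exact: derivable0|exact: derive0].
exact: is_derive_addZ.
Qed.

(** If [g2] were positive, [g1] would be positive just to the right of its zero at 0, and the mean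
    value theorem would push [g] above [g 0] there. *)
Lemma max_second_derivative (g g1 : R -> R) (del g2 : R) : 0 < del ->
  (forall s : R, `|s| < del -> is_derive s 1 g (g1 s)) ->
  is_derive (0 : R) 1 g1 g2 ->
  (forall s : R, `|s| < del -> g s <= g 0) -> g1 0 = 0 /\ g2 <= 0.
Proof.
move=> del0 dg dg1 gmax.
have inE (s : R) : s \in `]- del, del[ -> `|s| < del.
  by rewrite in_itv/= ltr_norml.
have g10 : g1 0 = 0.
  have d0 : `|0 : R| < del by rewrite normr0.
  have [_ <-] := dg _ d0.
  have : is_derive (0 : R) 1 g 0; last by case.
  apply: (@derive1_at_max _ _ (- del) del) => [|t /inE tdel||t /inE tdel].
  - lra.
  - by case: (dg _ tdel).
  - by rewrite in_itv/= oppr_lt0 del0.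
  - exact: gmax.
split => //; rewrite leNgt; apply/negP => g2pos.
have [/cvg_ex[/= l lE] lg2] := dg1.
have {}lg2 : l = g2 by rewrite -lg2; apply/esym/cvg_lim.
move: lE; rewrite lg2 => /cvgrPdist_lt/(_ _ g2pos).
case/nbhs_ballP => e /= e0 He.
pose h := Num.min e del / 2.
have h0 : 0 < h by rewrite divr_gt0// lt_min e0.
have [he hd] : h < e /\ h < del.
  have := ge_min e e del; have := ge_min del e del; rewrite !lexx orbT/= => A1 A2.
  rewrite /h; split; lra.
have g1pos (s : R) : 0 < s <= h -> 0 < g1 s.
  move=> /andP[s0 sh].
  have : ball (0 : R) e s by rewrite -ball_normE/= sub0r normrN gtr0_norm//; lra.
  move=> /He /(_ (lt0r_neq0 s0)) /=.
  rewrite scaler1 addr0 g10 subr0 /GRing.scale/= ltr_norml => /andP[_].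
  by rewrite ltrBlDr ltrDl pmulr_rgt0 ?invr_gt0.
have sub (s : R) : 0 <= s <= h -> `|s| < del.
  by move=> /andP[s0 sh]; rewrite ger0_norm//; lra.
have dgo (s : R) : s \in `]0, h[%R -> is_derive s 1 g (g1 s).
  by rewrite in_itv/= => /andP[s0 sh]; apply/dg/sub; rewrite !ltW.
have cg : {within `[0, h], continuous g}.
  apply: derivable_within_continuous => s; rewrite in_itv/= => /sub sd.
  by case: (dg _ sd).
have [s sh gE] := MVT h0 dgo cg.
have hdel : `|h| < del by rewrite gtr0_norm.
have := gmax _ hdel; rewrite leNgt => /negP; apply.
rewrite -subr_gt0 gE subr0 mulr_gt0// g1pos//.
by move: sh; rewrite in_itv/= => /andP[-> /ltW ->].
Qed.

(** Restrict [b] to the lines through [x] and use the one-variable test. The derivative [D v] along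
    [v] is a combination of the [b1 i], so differentiating it once more along [v] gives the Hessian
    form. *)
Lemma max_conditions n (b : 'rV[R]_n -> R) (b1 : 'I_n -> 'rV[R]_n -> R)
    (b2 : 'I_n -> 'I_n -> 'rV[R]_n -> R) (U : set 'rV[R]_n) (x : 'rV[R]_n) :
  open U -> U x ->
  (forall y i, U y -> is_derive y (delta_mx 0 i) b (b1 i y)) ->
  (forall y i, U y -> {for y, continuous (b1 i)}) ->
  (forall y i j, U y -> is_derive y (delta_mx 0 i) (b1 j) (b2 i j y)) ->
  (forall i j, {for x, continuous (b2 i j)}) ->
  (forall y, U y -> b y <= b x) ->
  (forall i, b1 i x = 0) /\
  (forall v : 'cV[R]_n, \sum_i \sum_j b2 i j x * (v i 0 * v j 0) <= 0).
Proof.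
move=> oU Ux d1 c1 d2 c2 bmax.
have nearU y : U y -> \forall z \near y, U z by move=> Uy; exact: open_nbhs_nbhs.
pose D (v y : 'rV[R]_n) : R := \sum_i v 0 i * b1 i y.
have D1 (v y : 'rV[R]_n) : U y -> is_derive y v b (D v y).
  move=> Uy; apply: is_derive_rV => i; last exact: c1.
  by apply: filterS (nearU _ Uy) => z Uz; exact: d1.
have D2 (v : 'rV[R]_n) :
    is_derive x v (D v) (\sum_j v 0 j * (\sum_i v 0 i * b2 i j x)).
  have -> : D v = \sum_j v 0 j \*: b1 j.
    by apply/funext => y; rewrite fct_sumE.
  apply: is_derive_sum => j; apply: is_deriveZ.
  apply: (@is_derive_rV _ _ (fun i => b2 i j)) => i //.
  by apply: filterS (nearU _ Ux) => z Uz; exact: d2.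
have main (v : 'rV[R]_n) : D v x = 0 /\
    \sum_j v 0 j * (\sum_i v 0 i * b2 i j x) <= 0.
  have /nbhs_ballP[e /= e0 He] := nearU _ Ux.
  have v0 : 0 < `|v| + 1 by rewrite ltr_wpDl.
  have Uline (s : R) : `|s| < e / (`|v| + 1) -> U (x + s *: v).
    rewrite ltr_pdivlMr// mulrDr mulr1 => sv; apply: He; rewrite -ball_normE/=.
    rewrite opprD addrA subrr sub0r normrN normrZ; apply: le_lt_trans sv.
    by rewrite lerDl.
  have := @max_second_derivative (fun s => b (x + s *: v))
    (fun s => D v (x + s *: v)) (e / (`|v| + 1)) _ (divr_gt0 e0 v0).
  rewrite scale0r addr0; apply => [s /Uline Us||s /Uline Us].
  - by apply: is_derive_line; exact: D1.
  - by apply: is_derive_line; rewrite scale0r addr0; exact: D2.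
  - exact: bmax.
split=> [i|v].
  have [+ _] := main (delta_mx 0 i).
  rewrite /D (bigD1 i)//= big1 => [|j ji]; rewrite mxE eqxx/= ?(negbTE ji) ?mul0r//.
  by rewrite eqxx mul1r addr0.
have [_] := main v^T; rewrite exchange_big; congr (_ <= _).
apply: eq_bigr => j _; rewrite mulr_sumr; apply: eq_bigr => i _.
by rewrite !mxE mulrA mulrC (mulrC (v i 0)).
Qed.

(* One-sided: the maximum may sit at the right end of the time interval. *)
Lemma derive_ge0_left_max (g : R -> R) (a b d : R) : a < b ->
  is_derive b 1 g d -> (forall t, a <= t <= b -> g t <= g b) -> 0 <= d.
Proof.
move=> ab [/cvg_ex[/= l lE] ld] gmax.
have {}ld : l = d by rewrite -ld; apply/esym/cvg_lim.
rewrite leNgt; apply/negP => d0.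
move: lE; rewrite ld => /cvgrPdist_lt/(_ (- d)); rewrite oppr_gt0 => /(_ d0).
case/nbhs_ballP => e /= e0 He.
pose h := Num.min e (b - a) / 2.
have ba : 0 < b - a by rewrite subr_gt0.
have h0 : 0 < h by rewrite divr_gt0// lt_min e0.
have [he hd] : h < e /\ h < b - a.
  have := ge_min e e (b - a); have := ge_min (b - a) e (b - a).
  rewrite !lexx orbT/= => A1 A2; rewrite /h; split; lra.
have : ball (0 : R) e (- h) by rewrite -ball_normE/= sub0r opprK gtr0_norm.
have hN : - h != 0 by rewrite oppr_eq0 gt_eqF.
move=> /He /(_ hN) /=.
rewrite scaler1 /GRing.scale/= ltr_norml => /andP[+ _].
have : 0 <= (- h)^-1 * (g (- h + b) - g b).
  rewrite mulr_le0 ?invr_le0 ?oppr_le0 ?(ltW h0)// subr_le0 gmax//.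
  apply/andP; split; lra.
lra.
Qed.

Lemma is_derive_exp_coord n (k : R) (i0 : 'I_n) (x v : 'rV[R]_n) :
  is_derive x v (fun y : 'rV[R]_n => expR (k * y 0 i0))
    (k * v 0 i0 * expR (k * x 0 i0)).
Proof.
apply: line_is_derive; pose a := k * x 0 i0.
have -> : (fun r : R => expR (k * (x + r *: v) 0 i0)) =
    expR \o (cst a + (k * v 0 i0) \*: id).
  apply/funext => r /=; rewrite !mxE; congr expR.
  by rewrite -[RHS]/(a + k * v 0 i0 * r) /a; ring.
rewrite [X in is_derive _ _ _ X]mulrC; apply: is_derive1_comp.
  apply: is_derive_eq; congr expR.
  by rewrite -[LHS]/(a + k * v 0 i0 * 0) mulr0 addr0.
by apply: is_derive_eq; rewrite add0r scaler1.
Qed.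

Lemma continuous_exp_coord n (k : R) (i0 : 'I_n) :
  continuous (fun y : 'rV[R]_n => expR (k * y 0 i0)).
Proof.
move=> y; apply: (@continuous_comp _ _ _ (fun y : 'rV[R]_n => k * y 0 i0) expR).
  by apply: (@cvgMl_tmp _ _ (nbhs y)); exact: coord_continuous.
exact: continuous_expR.
Qed.

End Derivatives.

(** * Comparison with exponential barriers on time slabs *)

Section Comparison.
Context {R : realType} {n : nat}.
Implicit Types (U : set 'rV[R]_n) (u : 'rV[R]_n -> R -> R).

Lemma open_cylinder U : open U -> open (cylinder U).
Proof.
move=> oU; have -> : cylinder U =
    (fst @^-1` U) `&` (snd @^-1` [set` `]0, +oo[ : interval R]).
  by [].
apply: openI; apply: open_comp.
- by move=> p _; exact: cvg_fst.
- exact: oU.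
- by move=> p _; exact: cvg_snd.
- exact: interval_open.
Qed.

(** Since the cylinder is open, continuity relative to it is ordinary continuity at its points,
    which passes to the slice at fixed time. *)
Lemma continuous_slice U (h : 'rV[R]_n -> R -> R) x t : open U -> U x -> 0 < t ->
  continuous_on (cylinder U) h -> {for x, continuous (h ^~ t)}.
Proof.
move=> oU Ux t0 ch.
have : {for (x, t), continuous (fun p : 'rV[R]_n * R => h p.1 p.2)}.
  move: ch; rewrite /continuous_on continuous_open_subspace; last exact: open_cylinder.
  by apply; rewrite inE; split => //=; rewrite in_itv/= t0.
move=> cxt; apply: (@continuous_comp _ _ _ (fun y => (y, t))
  (fun p : 'rV[R]_n * R => h p.1 p.2)) => //.
move=> W [[W1 W2] [/= HW1 HW2] WW]; apply: filterS HW1 => y W1y.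
by apply: WW; split => //=; exact: nbhs_singleton.
Qed.

(* Only one space variable and no modulus: [exp (k x_i0)] is the classical
   barrier whose second derivative beats any first order term once
   [k c0] exceeds the drift bound. *)
Definition barrier (c : R -> R) (eta k : R) (i0 : 'I_n)
    (x : 'rV[R]_n) (t : R) : R :=
  c t - eta * expR (k * x 0 i0).

(** The space maximum fixes the gradient of [u] and makes the Hessian of [u] minus the barrier
    negative semidefinite, so its inner product with the positive definite [A] is nonpositive. The
    past maximum bounds the time derivative from one side, which allows [t] to be the last time. *)
Lemma touching_conditions U u (A : 'M[R]_n) (c : R -> R) (c' eta k T0 t c0 : R)
    (i0 : 'I_n) (x : 'rV[R]_n) :
  open U -> C21 U u -> U x -> 0 < t -> T0 < t ->
  0 < c0 -> A^T = A -> (forall v, c0 * enorm v ^+ 2 <= quad A v) ->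
  is_derive t 1 c c' ->
  (forall y, U y ->
     u y t - barrier c eta k i0 y t <= u x t - barrier c eta k i0 x t) ->
  (forall s, T0 <= s <= t ->
     u x s - barrier c eta k i0 x s <= u x t - barrier c eta k i0 x t) ->
  [/\ gradx u x t = (- (eta * k * expR (k * x 0 i0))) *: delta_mx i0 0,
      c' <= dt u x t &
      mxinner A (hessx u x t) <= - (eta * k ^+ 2 * expR (k * x 0 i0)) * A i0 i0].
Proof.
move=> oU [_ du cdt cdx cdxx] Ux t0 T0t c00 Asym Apos dc xmax tmax.
have cyl y : U y -> cylinder U (y, t) by split => //=; rewrite in_itv/= t0.
have dt_ge : c' <= dt u x t.
  have [dut _ _] := du _ _ (cyl _ Ux).
  rewrite -subr_ge0; apply: (@derive_ge0_left_max _ (u x - c) T0 t) => //.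
    by rewrite /dt derive1E; apply: is_deriveB; exact/derivableP.
  move=> s /tmax; rewrite /barrier.
  by rewrite -[(u x - c) s]/(u x s - c s) -[(u x - c) t]/(u x t - c t); lra.
pose E (y : 'rV[R]_n) : R := expR (k * y 0 i0).
pose d i : R := (i == i0)%:R.
have dE y i : is_derive y (delta_mx 0 i) E (k * d i * E y).
  have -> : d i = (delta_mx 0 i : 'rV[R]_n) 0 i0 by rewrite mxE eqxx eq_sym.
  exact: is_derive_exp_coord.
(* At fixed [t] this function differs from [u] minus the barrier by the constant [c t]. *)
have := @max_conditions _ n (u^~ t + eta \*: E)
  (fun i => dx i u ^~ t + (eta * k * d i) \*: E)
  (fun i j => dx i (dx j u) ^~ t + (eta * k * d j * k * d i) \*: E) U x oU Ux.
have cE (a : R) y : {for y, continuous (a \*: E)}.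
  by apply: continuousZl_tmp; exact: continuous_exp_coord.
case.
- move=> y i Uy; have [_ dux _] := du _ _ (cyl _ Uy).
  have -> : (eta * k * d i) \*: E = eta \*: ((k * d i) \*: E).
    by apply/funext => z /=; rewrite scalerA mulrA.
  exact: is_deriveD (derivableP (dux i)) (is_deriveZ _ (dE y i)).
- move=> y i Uy; apply: continuousD; last exact: cE.
  exact: (@continuous_slice U).
- move=> y i j Uy; have [_ _ dux] := du _ _ (cyl _ Uy).
  have -> : (eta * k * d j * k * d i) \*: E = (eta * k * d j) \*: ((k * d i) \*: E).
    by apply/funext => z /=; rewrite scalerA !mulrA.
  exact: is_deriveD (derivableP (dux i j)) (is_deriveZ _ (dE y i)).
- move=> i j; apply: continuousD; last exact: cE.
  exact: (@continuous_slice U).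
- move=> y /xmax xm; rewrite -[leRHS]/(u x t + eta * E x) -[leLHS]/(u y t + eta * E y).
  by move: xm; rewrite /barrier -/(E x) -/(E y); lra.
move=> grad0 hess0; split => //.
  apply/colP => i; rewrite !mxE eqxx andbT.
  have := grad0 i; rewrite -[LHS]/(dx i u x t + eta * k * d i * E x) => /eqP.
  by rewrite addr_eq0 => /eqP ->; rewrite /d /E; ring.
(* The Hessian at [x] of [u^~ t + eta \*: E]; the barrier contributes only the entry [(i0, i0)]. *)
pose H := hessx u x t + (eta * k ^+ 2 * E x) *: delta_mx i0 i0.
have : mxinner A H <= 0.
  apply: (@mxinner_le0 _ _ _ _ c0) => // v; rewrite quadE.
  have := hess0 v; congr (_ <= _); apply: eq_bigr => i _; apply: eq_bigr => j _.
  congr (_ * _); rewrite !mxE.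
  rewrite -[LHS]/(dx i (dx j u) x t + eta * k * d j * k * d i * E x); congr (_ + _).
  by rewrite /d; case: (i == i0); case: (j == i0); rewrite /=; ring.
have -> : mxinner A H = mxinner A (hessx u x t) + eta * k ^+ 2 * E x * A i0 i0.
  rewrite /mxinner mulmxDr mxtraceD -scalemxAr mxtraceZ; congr (_ + _ * _).
  have := mxinnerE _ A (delta_mx i0 i0); rewrite /mxinner => ->.
  rewrite (bigD1 i0)//= (bigD1 i0)//= !big1 => [||j /negbTE ji];
    rewrite ?mxE ?eqxx ?mulr1 ?addr0//.
  - by move=> i /negbTE ii; rewrite big1 // => j _; rewrite mxE ii mulr0.
  - by rewrite ji andbF mulr0.
by rewrite mulNr /E => AH0; rewrite -subr_le0 opprK.
Qed.

Lemma bounded_closure U : bounded_set U ->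
  exists2 M : R, 0 < M & forall x, closure U x -> `|x| <= M.
Proof.
move=> /pinfty_ex_gt0[M M0 UM]; exists M => // x.
have cb := @closed_closed_ball_ R 'rV[R]_n 0 M.
have sub : U `<=` closed_ball_ Num.norm 0 M.
  by move=> y /UM; rewrite /closed_ball_/= sub0r normrN.
by move=> /(closureS sub); rewrite -(closure_id _).1// /closed_ball_/= sub0r normrN.
Qed.

Lemma compact_closure U : bounded_set U -> compact (closure U).
Proof.
move=> /bounded_closure[M M0 UM].
apply: bounded_closed_compact; last exact: closed_closure.
exists M; split => [|N MN x /= Ux]; first exact: gtr0_real.
by rewrite (le_trans (UM _ Ux))// ltW.
Qed.

Lemma compact_cylinder U (T0 T : R) : bounded_set U ->
  compact (closure U `*` `[T0, T]).
Proof.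
by move=> bU; apply: compact_setX; [exact: compact_closure|exact: segment_compact].
Qed.

Lemma continuous_slab U u (T0 T : R) :
  0 <= T0 -> continuous_on (closed_cylinder U) u ->
  {within closure U `*` `[T0, T], continuous (fun p => u p.1 p.2)}.
Proof.
move=> T00; apply: continuous_subspaceW => -[x t] [/= Ux].
rewrite in_itv/= => /andP[T0t _]; split => //=.
by rewrite in_itv/= andbT (le_trans T00).
Qed.

Lemma continuous_sub_barrier U u (c : R -> R) (eta k T0 T : R) (i0 : 'I_n) :
  0 <= T0 -> continuous_on (closed_cylinder U) u -> {within `[T0, T], continuous c} ->
  {within closure U `*` `[T0, T],
    continuous (fun p => u p.1 p.2 - barrier c eta k i0 p.1 p.2)}.
Proof.
move=> T00 cu cc.
have cu' := continuous_slab _ _ _ T T00 cu.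
have cE : {within closure U `*` `[T0, T],
    continuous (fun p : 'rV[R]_n * R => eta * expR (k * p.1 0 i0))}.
  apply: continuous_subspaceT => p.
  apply: (@cvgMl_tmp _ _ (nbhs p)).
  apply: (@continuous_comp _ _ _ fst (fun y : 'rV[R]_n => expR (k * y 0 i0))).
    exact: cvg_fst.
  exact: continuous_exp_coord.
have cc' : {within closure U `*` `[T0, T],
    continuous (fun p : 'rV[R]_n * R => c p.2)}.
  move/subspace_continuousP : cc => cc; apply/subspace_continuousP => -[x t] [/= Ux Tt].
  move=> W HW; have Hs := cc _ Tt _ HW.
  exists (setT, [set s | `[T0, T]%classic s -> W (c s)]).
    by split; [exact: filterT|exact: Hs].
  by move=> [y s] [/= _ Ws] [/= _ /Ws].
move=> p; apply: (@continuousB _ _ _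
  (from_subspace _ (fun p : 'rV[R]_n * R => u p.1 p.2))
  (from_subspace _ (fun p : 'rV[R]_n * R => c p.2 - eta * expR (k * p.1 0 i0)))).
  exact: cu'.
exact: (@continuousB _ _ _ _ _ _ (cc' p) (cE p)).
Qed.

(** A positive maximum of [u] minus the barrier over the compact slab avoids the initial time and
    the lateral boundary, so it is a touching point, where the strict inequality fails. That
    inequality is asked only where [u] has the gradient of the barrier; this is how a quasilinear
    equation enters a comparison that is linear in form. *)
Lemma comparison U u (A : 'rV[R]_n -> R -> 'M[R]_n) (c c' : R -> R)
    (eta k T0 T c0 : R) (i0 : 'I_n) :
  open U -> bounded_set U ->
  continuous_on (closed_cylinder U) u -> C21 U u -> 0 < c0 ->
  (forall x t, cylinder U (x, t) -> (A x t)^T = A x t) ->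
  (forall x t v, cylinder U (x, t) -> c0 * enorm v ^+ 2 <= quad (A x t) v) ->
  0 <= T0 -> {within `[T0, T], continuous c} ->
  (forall t, T0 < t <= T -> is_derive t 1 c (c' t)) ->
  (forall x t, U x -> T0 < t <= T ->
     gradx u x t = (- (eta * k * expR (k * x 0 i0))) *: delta_mx i0 0 ->
     dt u x t - mxinner (A x t) (hessx u x t) <
     c' t + eta * k ^+ 2 * expR (k * x 0 i0) * A x t i0 i0) ->
  (forall x, closure U x -> u x T0 <= barrier c eta k i0 x T0) ->
  (forall x t, frontier U x -> T0 < t <= T -> u x t <= barrier c eta k i0 x t) ->
  forall x t, closure U x -> T0 <= t <= T -> u x t <= barrier c eta k i0 x t.
Proof.
move=> oU bU cu c21 c00 Asym Apos T00 cc dc super init bdry x t Ux T0tT.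
have cK := @compact_cylinder U T0 T bU.
have xtK : (closure U `*` `[T0, T]) (x, t) by split => //=; rewrite in_itv.
have [[y s] /set_mem [/= Uy +] ysmax] :=
  compact_EVT_max (ex_intro _ _ xtK) cK
    (@continuous_sub_barrier _ _ c eta k _ _ i0 T00 cu cc).
rewrite in_itv/= => /andP[T0s sT].
have wmax z r : closure U z -> T0 <= r <= T ->
    u z r - barrier c eta k i0 z r <= u y s - barrier c eta k i0 y s.
  by move=> Uz rT; apply: (ysmax (z, r)); rewrite inE; split => //=; rewrite in_itv.
rewrite -subr_le0; apply: le_trans (wmax _ _ Ux T0tT) _; rewrite leNgt.
apply/negP => wpos.
have {}T0s : T0 < s.
  rewrite lt_neqAle T0s andbT; apply/eqP => sE.
  by move: wpos; rewrite -sE subr_gt0 ltNge init.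
have {}Uy : U y.
  apply: contrapT => Uy'; move: wpos; rewrite subr_gt0 ltNge bdry ?T0s//.
  by split => // /interior_subset.
have s0 : 0 < s by exact: le_lt_trans T0s.
have cyl : cylinder U (y, s) by split => //=; rewrite in_itv/= s0.
have sT' : T0 < s <= T by rewrite T0s.
have [] := @touching_conditions U u (A y s) c (c' s) eta k T0 s c0 i0 y
  oU c21 Uy s0 T0s c00 (Asym _ _ cyl) (fun v => Apos _ _ v cyl) (dc _ sT').
- by move=> z Uz; apply: wmax; [exact: subset_closure|rewrite ltW].
- move=> r /andP[T0r rs]; apply: wmax; first exact: subset_closure.
  by rewrite T0r (le_trans rs).
- move=> /(super _ _ Uy sT') sup tge hle.
  move: sup; apply/negP; rewrite -leNgt.
  by move: hle; rewrite mulNr; lra.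
Qed.

End Comparison.

(** * A monotone bounded primitive of the forcing *)

Section Primitive.
Context {R : realType}.
Notation mu := (@lebesgue_measure R).

(** [G t] is the integral of [F] from 0 to [t], and [l] the total integral. For negative [t] the
    domain is empty and [G t] is 0, so monotonicity and the bounds hold on the whole line. *)
Lemma integrable_primitive (F : R -> R) :
  {within `[0, +oo[, continuous F} -> (forall t, 0 <= t -> 0 <= F t) ->
  (\int[mu]_(t in `[0%R, +oo[) (F t)%:E < +oo)%E ->
  exists G : R -> R, exists l : R,
    [/\ forall T, {within `[0, T], continuous G},
        forall t : R, 0 < t -> is_derive t 1 G (F t),
        {homo G : s t / s <= t} &
        forall t, 0 <= G t <= l].
Proof.
move=> cF F0 Fint.
have cFT T : {within `[0, T], continuous F}.
  apply: continuous_subspaceW cF => t /=; rewrite !in_itv/= andbT.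
  by case/andP.
have iF T : mu.-integrable `[0, T] (EFin \o F).
  by apply: continuous_compact_integrable; [exact: segment_compact|exact: cFT].
have mF : measurable_fun ([set` `[0, +oo[] : set R) F.
  by apply: subspace_continuous_measurable_fun.
pose G t : R := parameterized_integral mu 0 t F.
have GE t : (G t)%:E = (\int[mu]_(s in `[0%R, t]) (F s)%:E)%E.
  by rewrite /G /parameterized_integral /Rintegral fineK//; exact: integrable_fin_num.
have le_int (D E : set R) : measurable D -> measurable E -> D `<=` E ->
    E `<=` [set` `[0, +oo[] ->
    (\int[mu]_(s in D) (F s)%:E <= \int[mu]_(s in E) (F s)%:E)%E.
  move=> mD mE DE E0; apply: ge0_subset_integral => //.
    by apply/measurable_EFinP; apply: measurable_funS mF.
  by move=> t /E0 /=; rewrite in_itv/= andbT lee_fin => /F0.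
exists G, (fine (\int[mu]_(t in `[0%R, +oo[) (F t)%:E)%E); split.
- move=> T; have [T0|T0] := leP 0 T.
    exact: parameterized_integral_continuous.
  by rewrite set_itv_ge ?bnd_simp -?ltNge//; exact: continuous_subspace0.
- move=> t t0.
  have cFt : {for t, continuous F}.
    apply: (@within_continuous_continuous _ _ _ 0 (t + 1)).
    + by rewrite ltr_wpDr// ltW.
    + exact: cFT.
    + by rewrite in_itv/= t0 ltrDl ltr01.
  (* The interval is extended beyond [t] to make [t] an interior point for the fundamental
     theorem. *)
  have tt1 : t < t + 1 by rewrite ltrDl.
  have [dG GF] := continuous_FTC1_closed tt1 (iF _) t0 cFt.
  by split => //; rewrite -GF derive1E.
- move=> s t st; rewrite -lee_fin !GE; apply: le_int => // r /=; rewrite !in_itv/=.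
    by case/andP=> -> rs; rewrite (le_trans rs).
  by rewrite andbT => /andP[].
- move=> t; rewrite -!lee_fin GE; apply/andP; split.
    by apply: integral_ge0 => r /=; rewrite in_itv/= lee_fin => /andP[/F0].
  rewrite fineK.
    apply: le_int => // r /=; rewrite !in_itv/= andbT.
    by case/andP.
  rewrite ge0_fin_numE//; apply: integral_ge0 => r /=.
  by rewrite in_itv/= andbT lee_fin => /F0.
Qed.

(** [T] is a point where [G] is within [eps] of its supremum, moved to the right to be positive. *)
Lemma homo_bounded_tail (G : R -> R) (l eps : R) : {homo G : s t / s <= t} ->
  (forall t, G t <= l) -> 0 < eps ->
  exists2 T, 0 < T & forall t, T <= t -> G t <= G T + eps.
Proof.
move=> Gle Gl eps0.
have supG : has_sup (range G).
  by split; [exists (G 0), 0|exists l => _ [t _ <-]].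
have [_ [s _ <-] sE] := sup_adherent eps0 supG.
exists (Num.max s 1); first by rewrite lt_max ltr01 orbT.
move=> t _; have : G t <= sup (range G) by apply: ub_le_sup; [case: supG|exists t].
have : G s <= G (Num.max s 1) by apply: Gle; rewrite le_max lexx.
lra.
Qed.

End Primitive.

(** * Upper bounds: global in time, then eventual *)

Section OneSided.
Context {R : realType} {n : nat}.
Implicit Types (U : set 'rV[R]_n) (u : 'rV[R]_n -> R -> R).

Lemma coord_le_norm (x : 'rV[R]_n) (i : 'I_n) : `|x 0 i| <= `|x|.
Proof.
by rewrite [leRHS]/Num.norm /= mx_normrE; apply/bigmax_geP; right; exists (0, i).
Qed.

Lemma is_derive_add_affine (G : R -> R) (a b t d : R) :
  is_derive t 1 G d -> is_derive t 1 (fun s => a + G s + b * s) (d + b).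
Proof.
move=> dG; have -> : (fun s => a + G s + b * s) = cst a + G + b \*: id by [].
by apply: is_derive_eq; rewrite add0r scaler1.
Qed.

Lemma continuous_add_affine (G : R -> R) (S : set R) (a b : R) :
  {within S, continuous G} -> {within S, continuous (fun s => a + G s + b * s)}.
Proof.
move=> cG s; apply: (@continuousD _ _ _ (from_subspace S (fun s => a + G s))
   (from_subspace S (fun s => b * s))).
  apply: (@continuousD _ _ _ (from_subspace S (cst a)) (from_subspace S G)).
    exact: cst_continuous.
  exact: cG.
by apply: continuous_subspaceT => r; exact: mulrl_continuous.
Qed.

Lemma slab_bound U u (T0 T : R) : bounded_set U ->
  continuous_on (closed_cylinder U) u -> 0 <= T0 ->
  exists M, forall x t, closure U x -> T0 <= t <= T -> u x t <= M.
Proof.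
move=> bU cu T00.
have cu' := continuous_slab _ _ _ T T00 cu.
have [K0|/set0P/negP/negPn/eqP K0] := pselect (closure U `*` `[T0, T] !=set0).
  have [p _ pmax] := compact_EVT_max K0 (compact_cylinder _ _ _ bU) cu'.
  exists (u p.1 p.2) => x t Ux T0t; apply: (pmax (x, t)).
  by rewrite inE; split => //=; rewrite in_itv.
(* The slab is empty, so any bound serves. *)
exists 0 => x t Ux T0t; suff : (closure U `*` `[T0, T]) (x, t) by rewrite K0.
by split => //=; rewrite in_itv.
Qed.

(** Here [z] is the length of the barrier gradient, [Q] the quadratic term, [m] the descent speed
    and [Z] the diffusion gain. Of the [b + 2] copies of [z] in [Z], [b] pay for the drift, one for
    [Q] and one, strictly, for [m]. *)
Let barrier_strict (f b z Q m Z : R) :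
  z * (b + 2) <= Z -> m < z -> Q <= z -> f + b * z + Q < f - m + Z.
Proof. lra. Qed.

Variables (U : set 'rV[R]_n) (u : 'rV[R]_n -> R -> R).
Variables (A : 'rV[R]_n -> R -> 'M[R]_n) (F G : R -> R) (c0 l : R) (i0 : 'I_n).
Hypotheses (oU : open U) (bU : bounded_set U).
Hypotheses (cu : continuous_on (closed_cylinder U) u) (c21 : C21 U u).
Hypotheses (c00 : 0 < c0)
  (Asym : forall x t, cylinder U (x, t) -> (A x t)^T = A x t)
  (Apos : forall x t v, cylinder U (x, t) -> c0 * enorm v ^+ 2 <= quad (A x t) v).
Hypotheses (cG : forall T, {within `[0, T], continuous G})
  (dG : forall t : R, 0 < t -> is_derive t 1 G (F t))
  (Gle : {homo G : s t / s <= t}) (Gl : forall t, 0 <= G t <= l).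

(** With [eta = 0] the barrier is constant in space, so the gradient vanishes at a touching point
    and only the forcing remains, which [G] absorbs at a cost of at most [l]. *)
Lemma global_upper_bound (T1 b : R) :
  (forall x t, cylinder U (x, t) -> gradx u x t = 0 ->
     dt u x t - mxinner (A x t) (hessx u x t) <= F t) ->
  (forall x t, frontier U x -> T1 <= t -> u x t <= b) ->
  exists N, forall x t, closure U x -> 0 <= t -> u x t <= N.
Proof.
move=> ineq bdry.
(* [M] covers the initial data and the lateral data before [T1]; later [b] takes over. *)
have [M UM] := @slab_bound U u 0 (Num.max 0 T1) bU cu (lexx 0).
pose N0 := Num.max M b.
exists (N0 + l + 1) => x t Ux t0.
(* A slope adapted to the final time [t]: it makes the inequality strict and adds less than 1 up to
   [t], so the bound does not depend on [t]. *)
have bt : 0 < (t + 1)^-1 by rewrite invr_gt0 ltr_wpDl.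
pose c s := N0 + G s + (t + 1)^-1 * s.
have N0c s : 0 <= s -> N0 <= c s.
  move=> s0; have /andP[Gs _] := Gl s.
  by rewrite /c -addrA lerDl addr_ge0// mulr_ge0// ltW.
have tt : 0 <= t <= t by rewrite t0 lexx.
have barE s (y : 'rV[R]_n) : barrier c 0 0 i0 y s = c s.
  by rewrite /barrier mul0r subr0.
have dc s : 0 < s <= t -> is_derive s 1 c (F s + (t + 1)^-1).
  by move=> /andP[s0 _]; exact: (is_derive_add_affine _ _ _ _ _ (dG _ s0)).
have := @comparison _ _ U u A c (fun s => F s + (t + 1)^-1) 0 0 0 t c0 i0 oU bU cu
  c21 c00 Asym Apos (lexx 0) (continuous_add_affine _ _ _ _ (@cG t)) dc.
move=> /(_ _ _ _ x t Ux tt); rewrite barE => cmp.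
have {cmp} : u x t <= c t.
  apply: cmp.
  - move=> y s Uy /andP[s0 st]; rewrite !mul0r oppr0 scale0r addr0 => grad0.
    have cyl : cylinder U (y, s) by split => //=; rewrite in_itv/= s0.
    by rewrite (le_lt_trans (ineq _ _ cyl grad0))// ltrDl.
  - move=> y Uy; rewrite barE; apply: le_trans (N0c _ (lexx 0)).
    by rewrite le_max UM// le_max !lexx.
  - move=> y s Uy /andP[s0 st]; rewrite barE; apply: le_trans (N0c _ (ltW s0)).
    rewrite le_max; have [sT|sT] := leP T1 s; first by rewrite bdry ?orbT.
    by rewrite UM//; [case: Uy|rewrite ltW//= le_max (ltW sT) orbT].
move=> /le_trans; apply; rewrite /c -!addrA lerD2l.
have /andP[_ Gt] := Gl t; apply: lerD => //.
by rewrite mulrC ler_pdivrMr ?ltr_wpDl// mul1r lerDl.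
Qed.

(* Start at a time [T0] after which the lateral data are below [b] and the forcing
   contributes at most [eps]. From height [M] at [T0] the barrier may descend at any
   speed [mu <= mu0]; since the admissible amplitude [eta] can be taken arbitrarily
   small, the quadratic gradient term is absorbed and the spatial profile
   costs only [eps]. Every final time [t >= T0 + (M - b) / mu0] gets its own
   speed, chosen so that the barrier lands near [b] exactly at [t]. *)
Lemma eventual_upper_bound (T1 b b0 q eps : R) : 0 <= q -> 0 <= b0 -> 0 < eps ->
  (forall x t p, cylinder U (x, t) -> gradx u x t = p *: delta_mx i0 0 ->
     dt u x t - mxinner (A x t) (hessx u x t) <= F t + b0 * `|p| + q * p ^+ 2) ->
  (forall x t, frontier U x -> T1 <= t -> u x t <= b) ->
  exists T, forall x t, closure U x -> T <= t -> u x t <= b + 3 * eps.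
Proof.
move=> q0 b00 eps0 ineq bdry.
have [T2 T20 GT2] := homo_bounded_tail _ _ _ Gle (fun t => (andP (Gl t)).2) eps0.
pose T0 := Num.max T1 T2.
have T1T0 : T1 <= T0 by rewrite le_max lexx.
have T00 : 0 < T0 by rewrite lt_max T20 orbT.
have GT0 t : T0 <= t -> G t <= G T0 + eps.
  move=> T0t; rewrite (le_trans (GT2 _ _))//.
    by rewrite (le_trans _ T0t)// le_max lexx orbT.
  by rewrite lerD2r Gle// le_max lexx orbT.
have [M' UM'] := @slab_bound U u T0 T0 bU cu (ltW T00).
(* Above [b] by at least 1, so that there is a positive height to descend. *)
pose M := Num.max M' (b + 1).
have UM x : closure U x -> u x T0 <= M.
  by move=> Ux; rewrite le_max UM' ?lexx.
have bM : 0 < M - b by rewrite subr_gt0 lt_max ltrDl ltr01 orbT.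
have [r r0 Ur] := bounded_closure _ bU.
(* The value [b0 + 2] is the factor required by [barrier_strict]. *)
have [k k0 kc] : exists2 k, 0 < k & k * c0 = b0 + 2.
  by exists ((b0 + 2) / c0); rewrite ?divfK ?gt_eqF// divr_gt0// ltr_wpDl.
pose E (x : 'rV[R]_n) := expR (k * x 0 i0).
pose Em := expR (- (k * r)); pose EM := expR (k * r).
have Em0 : 0 < Em by exact: expR_gt0.
have EM0 : 0 < EM by exact: expR_gt0.
have EmM x : closure U x -> Em <= E x <= EM.
  move=> Ux; rewrite !ler_expR -mulrN !ler_pM2l//.
  by rewrite -ler_norml (le_trans (coord_le_norm _ _))// Ur.
have qk0 : 0 < q * k + 1 by rewrite ltr_wpDl// mulr_ge0// ltW.
(* [e] will be the maximal size of [eta * E]: the first bound limits the cost of the profile to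
   [eps], the second makes the quadratic term at most the length of the gradient. *)
pose e := Num.min eps (q * k + 1)^-1.
have e0 : 0 < e by rewrite lt_min eps0 invr_gt0.
have [eta eta0 etaEM] : exists2 eta, 0 < eta & eta * EM = e.
  by exists (e / EM); rewrite ?divfK ?gt_eqF// divr_gt0.
have etaE x : closure U x -> eta * Em <= eta * E x <= e.
  by move=> /EmM; rewrite -etaEM !ler_pM2l.
(* Half of a lower bound for the gradient length, so that the speed stays strictly below it. *)
pose mu0 := eta * k * Em / 2.
have mu00 : 0 < mu0 by rewrite /mu0 divr_gt0// mulr_gt0// mulr_gt0.
exists (T0 + (M - b) / mu0) => x t Ux Tt.
have T0t : 0 < t - T0.
  rewrite (@lt_le_trans _ _ ((M - b) / mu0))//; first exact: divr_gt0.
  by rewrite lerBrDl.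
have [mu mu_gt0 muE] : exists2 mu, 0 < mu & mu * (t - T0) = M - b.
  by exists ((M - b) / (t - T0)); rewrite ?divfK ?gt_eqF// divr_gt0.
have mu_le : mu <= mu0.
  by rewrite -(ler_pM2r T0t) muE mulrC -ler_pdivrMr// lerBrDl.
(* The linear part falls from [M] at [T0] to [b] at [t], and [e] compensates the subtracted profile,
   so the barrier starts above [M] and never goes below [b]. *)
pose c s := M + e - G T0 + mu * T0 + G s + - mu * s.
have cE s : c s = M + e + (G s - G T0) - mu * (s - T0) by rewrite /c; ring.
have barE s (y : 'rV[R]_n) : barrier c eta k i0 y s = c s - eta * E y by [].
have cc : {within `[T0, t], continuous c}.
  apply: continuous_add_affine; apply: continuous_subspaceW (@cG t) => s /=.
  by rewrite !in_itv/= => /andP[T0s ->]; rewrite (le_trans (ltW T00)).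
have dc s : T0 < s <= t -> is_derive s 1 c (F s - mu).
  move=> /andP[T0s _].
  exact: (is_derive_add_affine _ _ _ _ _ (dG _ (lt_trans T00 T0s))).
have : u x t <= c t - eta * E x.
  apply: (@comparison _ _ U u A c (fun s => F s - mu) eta k T0 t c0 i0) => //.
  - exact: ltW.
  - move=> y s Uy /andP[T0s st] grad.
    have cyl : cylinder U (y, s) by split => //=; rewrite in_itv/= (lt_trans T00).
    apply: (le_lt_trans (ineq _ _ _ cyl grad)).
    have Uy' : closure U y by exact: subset_closure.
    (* Ellipticity tested on the basis vector. *)
    have Acc : c0 <= A y s i0 i0.
      have := Apos _ _ (delta_mx i0 0) cyl; rewrite enorm_sqr quadE.
      rewrite (bigD1 i0)//= big1 => [|i /negbTE ii]; last by rewrite mxE ii expr0n.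
      rewrite (bigD1 i0)//= (bigD1 i0)//= !big1 => [||i /negbTE ii].
      + by rewrite mxE !eqxx /= expr1n !mulr1 !addr0 mulr1.
      + by move=> i /negbTE ii; rewrite big1// => j _; rewrite !mxE ii mul0r mulr0.
      + by rewrite !mxE ii !mulr0.
    rewrite -/(E y).
    have /andP[E1 E2] := etaE _ Uy'.
    set w := eta * E y in E1 E2 *.
    have w0 : 0 < w by rewrite mulr_gt0// expR_gt0.
    have -> : eta * k * E y = k * w by rewrite /w; ring.
    have -> : eta * k ^+ 2 * E y = k ^+ 2 * w by rewrite /w; ring.
    have kw0 : 0 < k * w by exact: mulr_gt0.
    rewrite normrN gtr0_norm//.
    have : k * w * (k * c0) <= k ^+ 2 * w * A y s i0 i0.
      rewrite [leLHS](_ : _ = k ^+ 2 * w * c0); last ring.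
      by rewrite ler_pM2l// mulr_gt0// exprn_gt0.
    have : mu < k * w.
      apply: le_lt_trans mu_le _; rewrite /mu0.
      have : k * (eta * Em) <= k * w by rewrite ler_pM2l.
      have : 0 < eta * k * Em by rewrite mulr_gt0// mulr_gt0.
      lra.
    have : q * (- (k * w)) ^+ 2 <= k * w.
      have -> : q * (- (k * w)) ^+ 2 = (k * w) * (q * k * w) by ring.
      have qkw : q * k * w <= 1.
        have -> : 1 = (q * k + 1) * (q * k + 1)^-1 by rewrite divff// gt_eqF.
        have we : w <= (q * k + 1)^-1 by rewrite (le_trans E2)// ge_min lexx orbT.
        by apply: ler_pM => //; [rewrite mulr_ge0// ltW|exact: ltW|rewrite lerDl].
      by apply: ler_piMr => //; rewrite mulr_ge0// ltW.
    rewrite kc => Qz muz zZ; exact: barrier_strict zZ muz Qz.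
  - move=> y Uy; rewrite barE cE !subrr mulr0 addr0 subr0 (le_trans (UM _ Uy))//.
    by have /andP[_] := etaE _ Uy; lra.
  - move=> y s Uy /andP[T0s st]; rewrite barE cE.
    apply: le_trans (bdry _ _ Uy (le_trans T1T0 (ltW T0s))) _.
    have : mu * (s - T0) <= mu * (t - T0) by rewrite ler_pM2l// lerD2r.
    rewrite muE; have : G T0 <= G s by apply: Gle; rewrite ltW.
    have /andP[_] := etaE _ (proj1 Uy).
    lra.
  - by rewrite lexx andbT -subr_ge0 ltW.
(* At time [t] the barrier is [b + e + (G t - G T0)] minus the profile, and both excesses are at
   most [eps]. *)
rewrite cE muE.
have : e <= eps by rewrite ge_min lexx.
have := GT0 t; rewrite -subr_ge0 (ltW T0t) => /(_ isT).
have : 0 < eta * E x by rewrite mulr_gt0// expR_gt0.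
lra.
Qed.

End OneSided.

(** * Change of sign of [u] *)

Section Opposite.
Context {R : realType}.

(* No differentiability is needed: the junk value of a divergent limit is 0. *)
Lemma derive_opp (V : normedModType R) (f : V -> R) (x v : V) :
  'D_v (fun y => - f y) x = - 'D_v f x.
Proof.
have [df|ndf] := pselect (derivable f x v); first exact: deriveN.
have ndN : ~ derivable (fun y => - f y) x v.
  move=> dN; apply: ndf.
  have -> : f = - (fun y => - f y).
    by apply/funext => y; rewrite -[RHS]/(- - f y) opprK.
  exact: derivableN.
have p0 : point = 0 :> R by [].
have -> : 'D_v f x = point by exact: dvgP ndf.
by have -> : 'D_v (fun y => - f y) x = point; [exact: dvgP ndN|rewrite p0 oppr0].
Qed.

Context {n : nat}.
Implicit Types (U : set 'rV[R]_n) (u : 'rV[R]_n -> R -> R).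

Lemma dx_opp (i : 'I_n) u : dx i (fun x t => - u x t) = fun x t => - dx i u x t.
Proof. by apply/funext => x; apply/funext => t; exact: derive_opp. Qed.

Lemma dt_opp u : dt (fun (x : 'rV[R]_n) t => - u x t) = fun x t => - dt u x t.
Proof.
by apply/funext => x; apply/funext => t; rewrite /dt !derive1E; exact: derive_opp.
Qed.

Lemma gradx_opp u x t : gradx (fun (x : 'rV[R]_n) t => - u x t) x t = - gradx u x t.
Proof. by apply/colP => i; rewrite !mxE dx_opp. Qed.

Lemma hessx_opp u x t : hessx (fun (x : 'rV[R]_n) t => - u x t) x t = - hessx u x t.
Proof. by apply/matrixP => i j; rewrite !mxE !dx_opp. Qed.

Lemma mxinnerN (A H : 'M[R]_n) : mxinner A (- H) = - mxinner A H.
Proof. by rewrite /mxinner mulmxN raddfN. Qed.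

Lemma continuous_on_opp D u : continuous_on D u ->
  continuous_on D (fun (x : 'rV[R]_n) t => - u x t).
Proof. by move=> cu p; apply: continuousN; exact: cu. Qed.

Lemma C21_opp U u : C21 U u -> C21 U (fun x t => - u x t).
Proof.
move=> [cu du cdt cdx cdxx]; split.
- exact: continuous_on_opp.
- move=> x t /du[d1 d2 d3]; split.
  + exact: derivableN.
  + by move=> i; exact: (derivableN (d2 i)).
  + by move=> i j; rewrite dx_opp; exact: (derivableN (d3 i j)).
- by rewrite dt_opp; exact: (continuous_on_opp _ _ cdt).
- by move=> i; rewrite dx_opp; exact: (continuous_on_opp _ _ (cdx i)).
- by move=> i j; rewrite !dx_opp; exact: (continuous_on_opp _ _ (cdxx i j)).
Qed.

End Opposite.

(** * Confinement of [u] to a compact part of [J], and the resulting bound on [P'] *)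

Section Range.
Context {R : realType} {n : nat}.
Implicit Types (U : set 'rV[R]_n) (u : 'rV[R]_n -> R -> R).

Lemma bounded_set_itv (ba bb : bool) (x y : R) :
  bounded_set [set` Interval (BSide ba x) (BSide bb y)].
Proof.
exists (`|x| + `|y|); split => [|N MN z /= zJ]; first by rewrite realD.
have /andP[xz zy] : x <= z <= y.
  by move: zJ; rewrite in_itv/= => /andP[/lteifW -> /lteifW ->].
apply: le_trans (ltW MN); rewrite ler_norml.
have := ler_norm y; have := ler_norm (- x); rewrite normrN.
have := normr_ge0 x; have := normr_ge0 y.
by move=> *; apply/andP; split; lra.
Qed.

Lemma range_in_segment U u (J : set R) (s0 N : R) :
  is_interval J -> J s0 -> range_condition U J u ->
  (forall x t, closure U x -> 0 <= t -> - N <= u x t <= N) ->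
  exists m M, `[m, M] `<=` J /\
    forall x t, closure U x -> 0 <= t -> m <= u x t <= M.
Proof.
move=> iJ Js0 RC uN.
have ran x t (S : set R) : closure U x -> 0 <= t ->
    [set u p.1 p.2 | p in closed_cylinder U] `<=` S -> S (u x t).
  by move=> Ux t0; apply; exists (x, t) => //; split => //=; rewrite in_itv/= t0.
case: RC => [->|[Hc Ha Hb Hbd]]; first by exists (- N), N.
have : J = [set` Rhull J] by apply/is_intervalP.
(* One case for each pair of ends. Those with [+oo] on the left or [-oo] on the right describe an
   empty [J] and contradict [Js0]. *)
case: (Rhull J) => -[ba a|[]] [bb b|[]] JE.
- have [m [M [Jm JM mM]]] : exists m M, [/\ J m, J M &
    [set u p.1 p.2 | p in closed_cylinder U] `<=` `[m, M]].
    by apply: Hbd; rewrite JE; exact: bounded_set_itv.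
  exists m, M; split.
    by move=> s /=; rewrite in_itv/= => msM; exact: (iJ m M).
  by move=> x t Ux t0; have := ran x t _ Ux t0 mM; rewrite /= in_itv.
- by move: Js0; rewrite JE /= in_itv/= ?andbF.
- case: ba JE => JE.
  + exists a, (Num.max a N); split.
      by move=> s /=; rewrite JE/= !in_itv/= andbT => /andP[].
    move=> x t Ux t0; have := ran x t _ Ux t0 (Hc _ (or_introl JE)).
    rewrite JE /= in_itv/= andbT => ->.
    by rewrite le_max; have /andP[_ ->] := uN _ _ Ux t0; rewrite orbT.
  + have [m am um] := Ha _ JE.
    exists m, (Num.max m N); split.
      move=> s /=; rewrite JE/= !in_itv/= andbT => /andP[ms _].
      exact: lt_le_trans ms.
    move=> x t Ux t0; have := ran x t _ Ux t0 um.
    rewrite /= in_itv/= andbT => ->.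
    by rewrite le_max; have /andP[_ ->] := uN _ _ Ux t0; rewrite orbT.
- case: bb JE => JE.
  + have [M Mb uM] := Hb _ JE.
    exists (Num.min M (- N)), M; split.
      move=> s /=; rewrite JE/= !in_itv/= => /andP[_ sM].
      exact: le_lt_trans Mb.
    move=> x t Ux t0; have := ran x t _ Ux t0 uM.
    rewrite /= in_itv/= => ->; rewrite andbT.
    by rewrite ge_min; have /andP[-> _] := uN _ _ Ux t0; rewrite orbT.
  + exists (Num.min b (- N)), b; split.
      by move=> s /=; rewrite JE/= !in_itv/= => /andP[].
    move=> x t Ux t0; have := ran x t _ Ux t0 (Hc _ (or_intror JE)).
    rewrite JE /= in_itv/= => ->; rewrite andbT.
    by rewrite ge_min; have /andP[-> _] := uN _ _ Ux t0; rewrite orbT.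
- by move: Js0; rewrite JE /= in_itv/= ?andbF.
- by exists (- N), N; split => // s _; rewrite JE.
- by move: Js0; rewrite JE /= in_itv/= ?andbF.
- by move: Js0; rewrite JE /= in_itv/= ?andbF.
- by move: Js0; rewrite JE /= in_itv/= ?andbF.
Qed.

Lemma bounded_derive_on (J : set R) (P : R -> R) (m M : R) :
  C1_on J P -> `[m, M] `<=` J ->
  exists2 C, 0 <= C & forall s, m <= s <= M -> derive_on J P s <= C.
Proof.
move=> [_ cP] mMJ; have [mM|Mm] := leP m M.
  have [s0 _ smax] := EVT_max mM (continuous_subspaceW mMJ cP).
  exists (Num.max 0 (derive_on J P s0)); first by rewrite le_max lexx.
  by move=> s sm; rewrite le_max smax ?orbT// in_itv.
exists 0 => // s /andP[ms sM].
by move: (lt_le_trans Mm (le_trans ms sM)); rewrite ltxx.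
Qed.

End Range.

(** * Evaluation on coordinate vectors, and convergence of maxima *)

Section Conclusion.
Context {R : realType} {n : nat}.
Implicit Types (U : set 'rV[R]_n) (u : 'rV[R]_n -> R -> R).

Lemma enorm_delta (i : 'I_n) : enorm (delta_mx i 0 : 'cV[R]_n) = 1.
Proof.
have e0 : 0 <= enorm (delta_mx i 0 : 'cV[R]_n) by exact: sqrtr_ge0.
apply/eqP; rewrite -(@eqrXn2 _ 2)// enorm_sqr (bigD1 i)//= big1 => [|j /negbTE ji].
  by rewrite mxE !eqxx addr0.
by rewrite mxE ji expr0n.
Qed.

Lemma coord_le_enorm (v : 'cV[R]_n) (i : 'I_n) : `|v i 0| <= enorm v.
Proof.
have e0 : 0 <= enorm v by exact: sqrtr_ge0.
rewrite -(@ler_pXn2r _ 2)// ?nnegrE// real_normK ?num_real// enorm_sqr.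
by rewrite (bigD1 i)//= lerDl sumr_ge0// => j _; rewrite sqr_ge0.
Qed.

Lemma dot_deltaZ (v : 'cV[R]_n) (p : R) (i : 'I_n) :
  dot v (p *: delta_mx i 0) = p * v i 0.
Proof.
rewrite /dot (bigD1 i)//= big1 => [|j /negbTE ji]; last by rewrite !mxE ji !mulr0.
by rewrite !mxE !eqxx mulr1 addr0 mulrC.
Qed.

Lemma quad_delta (K : 'M[R]_n) (i : 'I_n) :
  quad K (delta_mx i 0) = K i i.
Proof.
rewrite quadE (bigD1 i)//= (bigD1 i)//= !big1 => [||j /negbTE ji].
- by rewrite !mxE !eqxx !mulr1 !addr0.
- by move=> j /negbTE ji; rewrite big1// => k _; rewrite !mxE ji mul0r mulr0.
- by rewrite !mxE ji !mulr0.
Qed.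

(** A touching gradient is a multiple of a basis vector, so [K] enters only through a diagonal
    entry, which the bounds on its quadratic form control. *)
Lemma dot_mulmx_deltaZ (K : 'M[R]_n) (p : R) (i : 'I_n) :
  dot (K *m (p *: delta_mx i 0)) (p *: delta_mx i 0) = p ^+ 2 * K i i.
Proof.
rewrite dot_deltaZ -scalemxAr mxE -colE mxE; ring.
Qed.

(** The maxima are gathered into a function by choice; as each is attained, a uniform bound on [h]
    is a bound on them. *)
Lemma max_cvg0 U (h : 'rV[R]_n -> R -> R) :
  (forall t, 0 < t -> exists m, is_max [set h x t | x in closure U] m) ->
  (forall x t, 0 <= h x t) ->
  (forall eps, 0 < eps ->
     exists T, forall x t, closure U x -> T <= t -> h x t <= eps) ->
  max_cvg (closure U) h 0.
Proof.
move=> hmax h0 hlim.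
have [m mP] : {m : R -> R & forall t, 0 < t ->
    is_max [set h x t | x in closure U] (m t)}.
  apply: (choice (P := fun t m => 0 < t -> is_max [set h x t | x in closure U] m)) => t.
  have [/hmax[y ?]|_] := ltP 0 t; first by exists y.
  (* A default value: nothing is asked at times [t <= 0]. *)
  by exists 0.
exists m => //; apply/cvgrPdist_le => eps eps0.
have [T hT] := hlim _ eps0.
near=> t.
have t0 : 0 < t by near: t; apply: nbhs_pinfty_gt; exact: num_real.
have Tt : T <= t by near: t; apply: nbhs_pinfty_ge; exact: num_real.
have [[x Ux <-] _] := mP _ t0.
by rewrite sub0r normrN ger0_norm// hT.
Unshelve. all: by end_near. Qed.

(** The slice is treated as the degenerate slab over [[t, t]], which is compact. *)
Lemma slice_max U u (l t : R) : U !=set0 -> bounded_set U ->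
  continuous_on (closed_cylinder U) u -> 0 < t ->
  exists m, is_max [set `|u x t - l| | x in closure U] m.
Proof.
move=> [x0 Ux0] bU cu t0.
have cu' := continuous_slab _ _ _ t (ltW t0) cu.
have ca : {within closure U `*` `[t, t], continuous (fun p => `|u p.1 p.2 - l|)}.
  move=> p; apply: (@continuous_comp _ _ _
    (from_subspace _ (fun p : 'rV[R]_n * R => u p.1 p.2 - l)) (fun r : R => `|r|)).
    apply: (@continuousB _ _ _ (from_subspace _ (fun p : 'rV[R]_n * R => u p.1 p.2))
      (from_subspace _ (cst l))); first exact: cu'.
    exact: cst_continuous.
  exact: norm_continuous.
have K0 : (closure U `*` `[t, t]) (x0, t).
  by split; [exact: subset_closure|rewrite /= in_itv/= lexx].
have [[x s] /set_mem [/= Ux +] xmax] :=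
  compact_EVT_max (ex_intro _ _ K0) (compact_cylinder _ _ _ bU) ca.
rewrite in_itv/= -eq_le => /eqP tE; subst s.
exists `|u x t - l|; split; first by exists x.
move=> _ [y Uy <-]; apply: (xmax (y, t)).
by rewrite inE; split => //=; rewrite in_itv/= lexx.
Qed.

End Conclusion.

(** * Bounds on the coefficients, then the two one-sided estimates combined *)

Theorem theorem5p6 (R : realType) (n : nat) (n_ge1 : (1 <= n)%N)
  (U : set 'rV[R]_n) (U_nonempty : U !=set0) (U_open : open U)
  (U_bounded : bounded_set U)
  (J : set R) (J_interval : is_interval J) (J_interior : interior J !=set0)
  (P : R -> R) (P_C1 : C1_on J P)
  (P'_ge0 : forall s, J s -> 0 <= derive_on J P s)
  (A K : 'rV[R]_n -> R -> 'M[R]_n)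
  (B : 'rV[R]_n -> R -> R -> 'cV[R]_n)
  (A_sym : forall x t, cylinder U (x, t) -> (A x t)^T = A x t)
  (c0 M1 c1 c2 : R)
  (c0_gt0 : 0 < c0) (M1_gt0 : 0 < M1) (c1_ge0 : 0 <= c1) (c2_ge0 : 0 <= c2)
  (A_elliptic : forall x t (xi : 'cV[R]_n), cylinder U (x, t) ->
    c0 * enorm xi ^+ 2 <= quad (A x t) xi)
  (A_trace : forall x t, cylinder U (x, t) -> \tr (A x t) <= M1)
  (K_bounds : forall x t (xi : 'cV[R]_n), cylinder U (x, t) ->
    - c1 * enorm xi ^+ 2 <= quad (K x t) xi <= c2 * enorm xi ^+ 2)
  (u : 'rV[R]_n -> R -> R)
  (u_cont : continuous_on (closed_cylinder U) u)
  (u_C21 : C21 U u)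
  (u_range : forall x t, cylinder U (x, t) -> J (u x t))
  (f g : 'rV[R]_n -> R -> R) (u0 : 'rV[R]_n -> R)
  (u_eq : forall x t, cylinder U (x, t) -> opL J P A K B u x t = f x t)
  (u_bdry : forall x t, frontier U x -> 0 < t -> u x t = g x t)
  (u_init : forall x, U x -> u x 0 = u0 x)
  (u_RC : range_condition U J u)
  (cB gamma0 : R) (cB_gt0 : 0 < cB) (gamma0_gt0 : 0 < gamma0)
  (B_growth : forall x t s, cylinder U (x, t) -> J s ->
    enorm (B x t s) <= cB * (1 + `|s|) `^ gamma0)
  (F : R -> R) (F_cont : {within `[0, +oo[, continuous F})
  (F_ge0 : forall t, 0 <= t -> 0 <= F t)
  (f_bound : forall x t, cylinder U (x, t) -> `|f x t| <= F t)
  (F_int : (\int[lebesgue_measure]_(t in `[0%R, +oo[) (F t)%:E < +oo)%E)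
  (ustar : R) (ustar_in : J ustar)
  (g_lim : max_cvg (frontier U) (fun x t => `|g x t - ustar|) 0) :
  max_cvg (closure U) (fun x t => `|u x t - ustar|) 0.
Proof.
have i0 : 'I_n by exact: Ordinal n_ge1.
have [G [l [cG dG Gle Gl]]] := integrable_primitive F F_cont F_ge0 F_int.
pose v x t := - u x t.
have cv : continuous_on (closed_cylinder U) v by exact: continuous_on_opp.
have v21 : C21 U v by exact: C21_opp.
have cyl0 x t : cylinder U (x, t) -> U x /\ 0 < t.
  by move=> [/= Ux]; rewrite in_itv/= andbT.
have Apos x t xi : cylinder U (x, t) -> c0 * enorm xi ^+ 2 <= quad (A x t) xi.
  exact: A_elliptic.
have [m m_max m_cvg] := g_lim.
have bdry eps : 0 < eps ->
    exists T, forall x t, frontier U x -> T <= t -> `|u x t - ustar| <= eps.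
  move=> eps0; move/cvgrPdist_le : m_cvg => /(_ _ eps0)[T [Treal mT]].
  (* Beyond this time [t] exceeds [T] strictly and is positive, so that [u] equals [g] on the
     boundary. *)
  exists (Num.max T 0 + 1) => x t Ux Tt.
  have /andP[Tt' t0] : (T < t) && (0 < t).
    by rewrite -gt_max; apply: lt_le_trans Tt; rewrite ltrDl.
  have [_ gm] := m_max _ t0.
  rewrite u_bdry//; apply: (@le_trans _ _ (m t)); first by apply: gm; exists x.
  by have := mT _ Tt'; rewrite sub0r normrN; apply: le_trans; exact: ler_norm.
(* The equation solved for its principal part at a point where the gradient has the direction of the
   barrier gradient. *)
have LuE x t p : cylinder U (x, t) -> gradx u x t = p *: delta_mx i0 0 ->
    dt u x t - mxinner (A x t) (hessx u x t) =
    f x t - p * B x t (u x t) i0 0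
    - derive_on J P (u x t) * (p ^+ 2 * K x t i0 i0).
  move=> cyl grad; have := u_eq _ _ cyl.
  by rewrite /opL grad dot_deltaZ dot_mulmx_deltaZ => <-; ring.
have grad_opp x t p : gradx v x t = p *: delta_mx i0 0 ->
    gradx u x t = - p *: delta_mx i0 0.
  by rewrite gradx_opp scaleNr => <-; rewrite opprK.
have vE x t : dt v x t - mxinner (A x t) (hessx v x t) =
    - (dt u x t - mxinner (A x t) (hessx u x t)).
  by rewrite dt_opp hessx_opp mxinnerN; ring.
(* Any fixed tolerance gives the eventual lateral bound needed for global boundedness. *)
have [T1 uT1] := bdry 1 ltr01.
have [N1 uN1] : exists N, forall x t, closure U x -> 0 <= t -> u x t <= N.
  apply: (@global_upper_bound _ _ U u A F G c0 l i0 U_open U_bounded u_cont u_C21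
    c0_gt0 A_sym Apos cG dG Gl T1 (ustar + 1)) => x t.
    move=> cyl grad; rewrite (LuE _ _ 0)// ?grad ?scale0r//.
    by have := f_bound _ _ cyl; rewrite ler_norml => /andP[_]; lra.
  by move=> Ux Tt; have := uT1 _ _ Ux Tt; rewrite ler_norml => /andP[_]; lra.
have [N2 vN2] : exists N, forall x t, closure U x -> 0 <= t -> v x t <= N.
  apply: (@global_upper_bound _ _ U v A F G c0 l i0 U_open U_bounded cv v21
    c0_gt0 A_sym Apos cG dG Gl T1 (- ustar + 1)) => x t.
    move=> cyl grad; rewrite vE (LuE _ _ 0)//.
      by have := f_bound _ _ cyl; rewrite ler_norml => /andP[]; lra.
    by rewrite (grad_opp _ _ 0) ?oppr0// scale0r.
  by move=> Ux Tt; have := uT1 _ _ Ux Tt; rewrite ler_norml /v => /andP[]; lra.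
pose N := Num.max `|N1| `|N2|.
have uN x t : closure U x -> 0 <= t -> - N <= u x t <= N.
  move=> Ux t0; have := vN2 _ _ Ux t0; have := uN1 _ _ Ux t0; rewrite /v.
  have : N1 <= N by rewrite le_max ler_norm.
  have : N2 <= N by rewrite le_max ler_norm orbT.
  by move=> *; apply/andP; split; lra.
have [mJ [MJ [mMJ uJ]]] := range_in_segment _ _ _ _ _ J_interval ustar_in u_RC uN.
have [C C0 PC] := bounded_derive_on _ _ _ _ P_C1 mMJ.
(* Bound on the drift over the range of [u], by monotonicity of the power. *)
pose b0 := cB * (1 + N) `^ gamma0.
have N0 : 0 <= N by rewrite le_max normr_ge0.
have b00 : 0 <= b0 by rewrite mulr_ge0 ?powR_ge0// ltW.
pose q := C * (c1 + c2).
have q0 : 0 <= q by rewrite mulr_ge0// addr_ge0.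
(* Bounding the absolute value serves both [u] and [v], since the right-hand side is even in [p]. *)
have key x t p : cylinder U (x, t) -> gradx u x t = p *: delta_mx i0 0 ->
    `|dt u x t - mxinner (A x t) (hessx u x t)| <= F t + b0 * `|p| + q * p ^+ 2.
  move=> cyl grad; rewrite (LuE _ _ _ cyl grad).
  have [Ux t0] := cyl0 _ _ cyl.
  have cUx : closure U x by exact: subset_closure.
  have Bb : `|B x t (u x t) i0 0| <= b0.
    apply: le_trans (coord_le_enorm _ _) _.
    apply: le_trans (B_growth _ _ _ cyl (u_range _ _ cyl)) _.
    rewrite ler_pM2l//; apply: ge0_ler_powR; rewrite ?nnegrE ?addr_ge0//.
      exact: ltW.
    by rewrite lerD2l ler_norml; apply: uN => //; exact: ltW.
  have Kb : `|K x t i0 i0| <= c1 + c2.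
    have := K_bounds _ _ (delta_mx i0 0) cyl.
    rewrite enorm_delta quad_delta expr1n !mulr1 => /andP[K1 K2].
    by rewrite ler_norml; apply/andP; split; lra.
  have Pb : `|derive_on J P (u x t)| <= C.
    have t0' := ltW t0; have Ju := u_range _ _ cyl.
    by rewrite ger0_norm; [apply: PC; exact: uJ|exact: P'_ge0].
  apply: le_trans (ler_normB _ _) _; apply: lerD.
    apply: le_trans (ler_normB _ _) _; apply: lerD; first exact: f_bound.
    by rewrite normrM mulrC ler_wpM2r.
  rewrite normrM normrM (ger0_norm (sqr_ge0 p)) /q mulrCA [leRHS]mulrC.
  by apply: ler_wpM2l; [exact: sqr_ge0|exact: ler_pM].
apply: max_cvg0 => [t t0|x t|eps eps0]; [exact: slice_max|exact: normr_ge0|].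
(* One quarter for the boundary tolerance and three for the loss in [eventual_upper_bound]. *)
have e0 : 0 < eps / 4 by rewrite divr_gt0.
have [T2 uT2] := bdry _ e0.
have [T3 uT3] : exists T, forall x t, closure U x -> T <= t ->
    u x t <= ustar + eps / 4 + 3 * (eps / 4).
  apply: (@eventual_upper_bound _ _ U u A F G c0 l i0 U_open U_bounded u_cont
    u_C21 c0_gt0 A_sym Apos cG dG Gle Gl T2 (ustar + eps / 4) b0 q (eps / 4)) => //.
    by move=> x t p cyl grad; exact: le_trans (ler_norm _) (key _ _ _ cyl grad).
  by move=> x t Ux Tt; have := uT2 _ _ Ux Tt; rewrite ler_norml => /andP[]; lra.
have [T4 vT4] : exists T, forall x t, closure U x -> T <= t ->
    v x t <= - ustar + eps / 4 + 3 * (eps / 4).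
  apply: (@eventual_upper_bound _ _ U v A F G c0 l i0 U_open U_bounded cv
    v21 c0_gt0 A_sym Apos cG dG Gle Gl T2 (- ustar + eps / 4) b0 q (eps / 4)) => //.
    move=> x t p cyl grad; rewrite vE; apply: le_trans (ler_norm _) _.
    rewrite normrN -(normrN p) -(sqrrN p); apply: key => //; exact: grad_opp.
  move=> x t Ux Tt; have := uT2 _ _ Ux Tt; rewrite ler_norml /v => /andP[]; lra.
exists (Num.max T3 T4) => x t Ux; rewrite ge_max => /andP[T3t T4t].
have := uT3 _ _ Ux T3t; have := vT4 _ _ Ux T4t; rewrite /v => v4 u4.
by rewrite ler_norml; apply/andP; split; lra.
Qed.
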